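(* Let $\mathcal{T}_1,\mathcal{T}_2,\mathcal{T}$ be graph matrices (as described in the context), and for a positive integer $N$ and a square matrix $M$ put $$\mathcal{C}(N,M)=\frac1N\sum_{g\mid N}\mu(g)\,\mathrm{Tr}\,M^{N/g}.$$ Let $\otimes$ denote the Kronecker product of matrices. Then for every positive integer $N$, $$\sum_{[s,t]=N}(s,t)\,\mathcal{C}(s,\mathcal{T}_1)\,\mathcal{C}(t,\mathcal{T}_2)=\mathcal{C}(N,\mathcal{T}_1\otimes\mathcal{T}_2),$$ where the summation is over the pairs of positive integers $(s,t)$ whose least common multiple $[s,t]$ is $N$. Also, for all positive integers $N$ and $l$, $$\mathcal{C}(N,\mathcal{T}^{l})=\sum_{[l,t]=Nl}\frac{t}{N}\,\mathcal{C}(t,\mathcal{T}),$$ where the summation is over the positive integers $t$ with $[l,t]=Nl$; and for all positive integers $N,r,s$, $$(r,s)\,\mathcal{C}\left(N,\mathcal{T}_1^{\,s/(r,s)}\otimes\mathcal{T}_2^{\,r/(r,s)}\right)=\sum (rp,sq)\,\mathcal{C}(p,\mathcal{T}_1)\,\mathcal{C}(q,\mathcal{T}_2),$$ where the sum is over the positive integers $p$ and $q$ such that $pq/(pr,qs)=N/(r,s)$.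
   Context: $[a,b]$ denotes the least common multiple and $(a,b)$ the greatest common divisor of the positive integers $a,b$ (in sums, coefficients such as $(s,t)$ and $(rp,sq)$ are greatest common divisors); $\mu$ is the Möbius function; sums over $g\mid N$ run over the positive divisors of $N$. Graph matrices. The matrix $\mathcal{T}$ associated with a graph $G$ stands for any one of $T$, $A_d$, $T_d$ defined as follows. Graphs may have multiple edges and loops. (i) $G=(V,E)$ a finite connected undirected graph with no 1-degree vertices. Orient the edges $e_1,\dots,e_{|E|}$ arbitrarily and add the oppositely oriented edges $e_{|E|+i}=(e_i)^{-1}$, $1\le i\le |E|$ (for a loop $e_i$, $e_{|E|+i}$ is an additional oriented loop at the same vertex). The edge adjacency matrix $T$ is the $2|E|\times 2|E|$ matrix with $T_{ij}=1$ if the end vertex of $e_i$ is the start vertex of $e_j$ and $e_j$ is not the inverse edge of $e_i$, and $T_{ij}=0$ otherwise. (ii) $G=(V,E)$ a finite, strongly connected directed graph with no 1-degree vertices. The directed vertex adjacency matrix $A_d$ is the $|V|\times|V|$ matrix whose $(i,j)$ entry is the number of edges directed from vertex $i$ to vertex $j$. The directed edge adjacency matrix $T_d$ is the $|E|\times|E|$ matrix with $(T_d)_{ij}=1$ if the end vertex of edge $i$ is the start vertex of edge $j$, and $0$ otherwise. *)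

(* Defs.v *)
From HB Require Import structures.
From mathcomp Require Import all_boot all_order all_algebra.
From mathcomp Require Export mxtens.

Set Implicit Arguments.
Unset Strict Implicit.
Unset Printing Implicit Defensive.

Import Order.TTheory GRing.Theory Num.Theory.
Local Open Scope ring_scope.

(* Vertices and edges are numbered, since they index rows and columns of
   matrices.  The set of ends of an edge is a pair, or a singleton for a loop. *)
Record multigraph := Multigraph {
  ug_nv : nat;
  ug_ne : nat;
  ug_ends : 'I_ug_ne -> {set 'I_ug_nv};
  ug_endsP : forall e, (0 < #|ug_ends e| <= 2)%N
}.

Definition ug_adj (G : multigraph) : rel 'I_(ug_nv G) :=
  fun u v => [exists e : 'I_(ug_ne G), ug_ends e == [set u; v]].

Definition ug_connected (G : multigraph) : Prop :=
  (0 < ug_nv G)%N /\ forall u v, connect (@ug_adj G) u v.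

(* A loop counts twice in the degree of its vertex. *)
Definition ug_degree (G : multigraph) (v : 'I_(ug_nv G)) : nat :=
  (\sum_(e < ug_ne G) ((v \in ug_ends e) + (ug_ends e == [set v])))%N.

Definition is_orientation (G : multigraph)
    (o : 'I_(ug_ne G) -> 'I_(ug_nv G) * 'I_(ug_nv G)) : Prop :=
  forall e, ug_ends e = [set (o e).1; (o e).2].

(* The oriented edges are numbered by 'I_(m + m), m the number of edges: the
   first m are the edges oriented by o, the last m their inverses. *)
Definition oedge_start (m n : nat) (o : 'I_m -> 'I_n * 'I_n)
    (i : 'I_(m + m)) : 'I_n :=
  match split i with inl e => (o e).1 | inr e => (o e).2 end.

Definition oedge_end (m n : nat) (o : 'I_m -> 'I_n * 'I_n)
    (i : 'I_(m + m)) : 'I_n :=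
  match split i with inl e => (o e).2 | inr e => (o e).1 end.

Definition oedge_inv (m : nat) (i : 'I_(m + m)) : 'I_(m + m) :=
  match split i with inl e => rshift m e | inr e => lshift m e end.

Definition edge_adj_mx (m n : nat) (o : 'I_m -> 'I_n * 'I_n)
    : 'M[rat]_(m + m) :=
  \matrix_(i, j)
    ((oedge_end o i == oedge_start o j) && (j != oedge_inv i))%:R.

Record digraph := Digraph {
  dg_nv : nat;
  dg_ne : nat;
  dg_src : 'I_dg_ne -> 'I_dg_nv;
  dg_tgt : 'I_dg_ne -> 'I_dg_nv
}.

Definition dg_adj (D : digraph) : rel 'I_(dg_nv D) :=
  fun u v => [exists e : 'I_(dg_ne D), (dg_src e == u) && (dg_tgt e == v)].

Definition dg_strongly_connected (D : digraph) : Prop :=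
  (0 < dg_nv D)%N /\ forall u v, connect (@dg_adj D) u v.

(* In-degree plus out-degree. *)
Definition dg_degree (D : digraph) (v : 'I_(dg_nv D)) : nat :=
  (#|[set e : 'I_(dg_ne D) | dg_src e == v]|
   + #|[set e : 'I_(dg_ne D) | dg_tgt e == v]|)%N.

Definition dg_vertex_adj_mx (D : digraph) : 'M[rat]_(dg_nv D) :=
  \matrix_(i, j)
    #|[set e : 'I_(dg_ne D) | (dg_src e == i) && (dg_tgt e == j)]|%:R.

Definition dg_edge_adj_mx (D : digraph) : 'M[rat]_(dg_ne D) :=
  \matrix_(i, j) (dg_tgt i == dg_src j)%:R.

Inductive graph_matrix : forall n : nat, 'M[rat]_n -> Prop :=
| GraphMatrixT (G : multigraph)
    (o : 'I_(ug_ne G) -> 'I_(ug_nv G) * 'I_(ug_nv G)) :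
    ug_connected G -> (forall v : 'I_(ug_nv G), ug_degree v <> 1%N) ->
    is_orientation o -> graph_matrix (edge_adj_mx o)
| GraphMatrixAd (D : digraph) :
    dg_strongly_connected D -> (forall v : 'I_(dg_nv D), dg_degree v <> 1%N) ->
    graph_matrix (dg_vertex_adj_mx D)
| GraphMatrixTd (D : digraph) :
    dg_strongly_connected D -> (forall v : 'I_(dg_nv D), dg_degree v <> 1%N) ->
    graph_matrix (dg_edge_adj_mx D).

(* The Moebius function, for n > 0. *)
Definition mobius (n : nat) : rat :=
  if all (fun p => logn p n == 1%N) (primes n)
  then (-1) ^+ size (primes n) else 0.

Definition circ (N : nat) (n : nat) (M : 'M[rat]_n) : rat :=
  N%:R^-1 * \sum_(g <- divisors N) mobius g * \tr (M ^+ (N %/ g)).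

(* The next three lemmas show that the finite ranges used to write the sums
   over (s, t) with [s, t] = N, over t with [l, t] = N l, and over (p, q) with
   pq / (pr, qs) = N / (r, s) omit no pair of positive integers. *)
Lemma lcm_pair_range (N s t : nat) :
  (0 < N)%N -> lcmn s t = N -> s \in divisors N /\ t \in divisors N.
Proof. by move=> N0 eN; rewrite -!dvdn_divisors // -eN dvdn_lcml dvdn_lcmr. Qed.

Lemma lcm_range (N l t : nat) :
  (0 < N)%N -> (0 < l)%N -> lcmn l t = (N * l)%N -> t \in divisors (N * l).
Proof.
by move=> N0 l0 e; rewrite -dvdn_divisors ?muln_gt0 ?N0 // -e dvdn_lcmr.
Qed.

Lemma pq_range (N r s p q : nat) :
  (0 < N)%N -> (0 < r)%N -> (0 < s)%N -> (0 < p)%N -> (0 < q)%N ->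
  (p * q)%:R / (gcdn (p * r) (q * s))%:R = N%:R / (gcdn r s)%:R :> rat ->
  (p <= N * s)%N /\ (q <= N * r)%N.
Proof.
move=> N0 r0 s0 p0 q0 /eqP; have g0 : (0 < gcdn r s)%N by rewrite gcdn_gt0 r0.
have h0 : (0 < gcdn (p * r) (q * s))%N by rewrite gcdn_gt0 muln_gt0 p0 r0.
rewrite eqr_div ?pnatr_eq0 -?lt0n // -!natrM eqr_nat => /eqP e.
have le_pq : (p * q <= N * gcdn (p * r) (q * s))%N by rewrite -e leq_pmulr.
split.
- rewrite -(leq_pmul2r q0) (leq_trans le_pq) // -mulnA leq_mul //.
  by rewrite [(s * q)%N]mulnC dvdn_leq ?dvdn_gcdr // muln_gt0 q0.
- rewrite -(leq_pmul2r p0) [(q * p)%N]mulnC (leq_trans le_pq) // -mulnA.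
  by rewrite leq_mul // [(r * p)%N]mulnC dvdn_leq ?dvdn_gcdl // muln_gt0 p0.
Qed.

(* Main.v *)
Require Import Defs.
From mathcomp Require Import all_boot all_order all_algebra.
From mathcomp Require Import ring.

Import GRing.Theory Num.Theory.
Local Open Scope ring_scope.

(** The number N C(N, M) is the Moebius transform of N |-> Tr M^N, so the
    inversion formula says that d |-> C(d, M) is the only function c on the
    positive integers with
      sum_(d | m) d c(d) = Tr M^m    for every m > 0
    (trace_exp_circ and divisor_sums_inj).  Each of the three identities
    computes some C(N, M) as a sum of weights w(i) over the indices i whose
    key, a positive integer attached to i, equals N.  It is therefore enough
    to check, for all m > 0,
      sum over the i whose key divides m of key(i) w(i) = Tr M^m,
    which is circ_fibre.

    For a product, Tr (A (x) B)^m = Tr A^m Tr B^m, hence with a, b coprime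
      Tr (T1^a (x) T2^b)^m = Tr T1^(a m) Tr T2^(b m)
        = sum_(p | a m) sum_(q | b m) p q C(p, T1) C(q, T2).
    The conditions p | a m and q | b m together say that pq divides both
    p b m and q a m, that is, that the integer pq / (p b, q a) divides m
    (dvdn_tens_key).  Taking this integer as the key, the weight of (p, q) is
    (p b, q a) C(p, T1) C(q, T2), which is circ_tens_exp.  The case a = b = 1,
    where the key is the least common multiple, is the first identity; the
    third has a = s / (r, s) and b = r / (r, s), multiplied by (r, s).  For a power,
    Tr T^(l m) is the sum of t C(t, T) over t | l m, and t | l m means that
    [l, t] / l divides m, which gives the second identity (circ_exp). *)

(** * Moebius inversion *)

Lemma big_divisors_compl (V : nmodType) (n : nat) (H : nat -> V) : (0 < n)%N ->
  \sum_(g <- divisors n) H g = \sum_(g <- divisors n) H (n %/ g)%N.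
Proof.
move=> n0; have inj : {in divisors n &, injective (fun g => n %/ g)%N}.
  move=> a b; rewrite -!dvdn_divisors // => an bn e.
  by rewrite -(mulKn a n0) -(mulKn b n0) -!divnA // e.
rewrite -(big_map (fun g => n %/ g)%N xpredT); apply: perm_big.
apply: uniq_perm; rewrite ?divisors_uniq ?map_inj_in_uniq ?divisors_uniq // => g.
rewrite -dvdn_divisors //; apply/idP/mapP => [gn|[h]].
  exists (n %/ g)%N; last by rewrite divnA // mulKn.
  by rewrite -dvdn_divisors ?dvdn_div.
by rewrite -dvdn_divisors // => hn ->; rewrite dvdn_div.
Qed.

Lemma big_divisors_mul (V : nmodType) (n k : nat) (H : nat -> V) :
  (0 < n)%N -> (k %| n)%N ->
  \sum_(d <- divisors n | (k %| d)%N) H d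
  = \sum_(g <- divisors (n %/ k)) H (k * g)%N.
Proof.
move=> n0 kn; have k0 : (0 < k)%N by apply: dvdn_gt0 kn.
have nk0 : (0 < n %/ k)%N by rewrite divn_gt0 // dvdn_leq.
rewrite -big_filter -(big_map (muln k) xpredT); apply: perm_big.
apply: uniq_perm; first by rewrite filter_uniq ?divisors_uniq.
  rewrite map_inj_uniq ?divisors_uniq // => a b /eqP.
  by rewrite eqn_pmul2l // => /eqP.
move=> d; rewrite mem_filter -dvdn_divisors //; apply/andP/mapP => [[kd dn]|[h]].
  exists (d %/ k)%N; last by rewrite mulnC divnK.
  by rewrite -dvdn_divisors // dvdn_divRL // divnK.
by rewrite -dvdn_divisors // dvdn_divRL // => hn ->; rewrite dvdn_mulr // mulnC.
Qed.

Lemma mobius_mul_prime (p h : nat) : prime p -> (0 < h)%N -> ~~ (p %| h)%N ->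
  mobius (p * h) = - mobius h.
Proof.
move=> pp h0 ph; have p0 := prime_gt0 pp.
have pph : p \notin primes h by rewrite mem_primes pp h0.
have eqp : perm_eq (primes (p * h)) (p :: primes h).
  apply: uniq_perm; rewrite ?primes_uniq //= ?pph ?primes_uniq // => q.
  by rewrite primesM // primes_prime // !inE.
rewrite /mobius (perm_all _ eqp) (perm_size eqp) /= lognM // logn_prime // eqxx.
have /eqP-> : logn p h == 0%N by rewrite -leqn0 leqNgt logn_gt0.
rewrite /= (@eq_in_all _ _ (fun q => logn q h == 1%N)) => [|q qh].
  by case: ifP => _; rewrite ?oppr0 // exprS mulN1r.
rewrite lognM // logn_prime //; case: (q =P p) => // qp.
by rewrite -qp qh in pph.
Qed.

Lemma mobius_square (p n : nat) : prime p -> (0 < n)%N -> (p ^ 2 %| n)%N ->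
  mobius n = 0.
Proof.
move=> pp n0; rewrite pfactor_dvdn // => p2; rewrite /mobius ifN //.
apply/allPn; exists p; first by rewrite -logn_gt0 (leq_trans _ p2).
by case: (logn p n) p2 => [|[]].
Qed.

(** For a prime p dividing n, the divisors of n with nonzero Moebius value fall
    into pairs h, p h with h prime to p, and the two values are opposite. *)
Lemma sum_mobius (n : nat) : (0 < n)%N ->
  \sum_(g <- divisors n) mobius g = (n == 1%N)%:R.
Proof.
move=> n0; case: eqP => [->|/eqP n1]; first by rewrite big_seq1 /mobius.
have pp : prime (pdiv n) by rewrite pdiv_prime // ltn_neqAle eq_sym n1.
have pn : (pdiv n %| n)%N := pdiv_dvd n; move: (pdiv n) pp pn => p pp pn.
have np0 : (0 < n %/ p)%N by rewrite divn_gt0 ?prime_gt0 // dvdn_leq.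
rewrite (bigID (dvdn p)) /= big_divisors_mul //.
(* If p still divides h then p h is not squarefree. *)
rewrite (bigID (dvdn p)) /= big1_seq ?add0r => [|h /andP[ph]]; last first.
  rewrite -dvdn_divisors // => hn; have h0 := dvdn_gt0 np0 hn.
  apply: (@mobius_square p) => //; first by rewrite muln_gt0 prime_gt0.
  by rewrite expnS expn1 dvdn_pmul2l ?prime_gt0.
have -> : \sum_(h <- divisors (n %/ p) | ~~ (p %| h)%N) mobius (p * h)
        = - \sum_(h <- divisors n | ~~ (p %| h)%N) mobius h.
  rewrite -sumrN -!(big_filter _ (fun h => ~~ (p %| h)%N)).
  rewrite (perm_big [seq h <- divisors n | ~~ (p %| h)%N]) /=; last first.
    apply: uniq_perm; rewrite ?filter_uniq ?divisors_uniq // => h.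
    rewrite !mem_filter -!dvdn_divisors //; case: (boolP (p %| h)%N) => //= ph.
    by rewrite dvdn_divRL // Gauss_dvd ?pn ?andbT // coprime_sym prime_coprime.
  apply: eq_big_seq => h; rewrite mem_filter -dvdn_divisors // => /andP[ph hn].
  by rewrite mobius_mul_prime // (dvdn_gt0 n0).
by rewrite addNr.
Qed.

Lemma mobius_inversion (F : nat -> rat) (n : nat) : (0 < n)%N ->
  \sum_(d <- divisors n) \sum_(g <- divisors d) mobius g * F (d %/ g)%N = F n.
Proof.
move=> n0.
transitivity (\sum_(d <- divisors n) \sum_(k <- divisors n | (k %| d)%N)
                mobius (d %/ k) * F k).
  apply: eq_big_seq => d; rewrite -dvdn_divisors // => dn.
  have d0 := dvdn_gt0 n0 dn.
  rewrite big_divisors_compl // -(big_filter _ (fun k => k %| d)%N).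
  rewrite [RHS](perm_big (divisors d)) /=; last first.
    apply: uniq_perm; rewrite ?filter_uniq ?divisors_uniq // => k.
    rewrite mem_filter -!dvdn_divisors //; case: (boolP (k %| d)%N) => //= kd.
    exact: dvdn_trans dn.
  apply: eq_big_seq => k; rewrite -dvdn_divisors // => kd.
  by rewrite divnA // mulKn.
rewrite (exchange_big_dep xpredT) //=.
transitivity (\sum_(k <- divisors n) (k == n)%:R * F k).
  apply: eq_big_seq => k; rewrite -dvdn_divisors // => kn.
  have k0 := dvdn_gt0 n0 kn.
  rewrite (big_divisors_mul _ _ _ (fun d => mobius (d %/ k) * F k)) //.
  rewrite -big_distrl /=; congr (_ * _).
  under eq_bigr => g _ do rewrite mulKn //.
  have -> : (k == n) = (n %/ k == 1)%N.
    by rewrite -[RHS](eqn_pmul2r k0) divnK // mul1n eq_sym.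
  by rewrite sum_mobius // divn_gt0 // dvdn_leq.
rewrite (bigD1_seq n) ?divisors_uniq ?divisors_id //= eqxx mul1r.
by rewrite big1 ?addr0 // => k /negPf->; rewrite mul0r.
Qed.

(** The system of divisor sums is triangular with unit diagonal. *)
Lemma divisor_sums_inj (V : zmodType) (a b : nat -> V) :
  (forall m, (0 < m)%N ->
     \sum_(d <- divisors m) a d = \sum_(d <- divisors m) b d) ->
  forall N, (0 < N)%N -> a N = b N.
Proof.
move=> eab N; elim/ltn_ind: N => N IH N0; have := eab N N0.
rewrite !(bigD1_seq N) ?divisors_uniq ?divisors_id //=.
suff -> : \sum_(d <- divisors N | d != N) a d
        = \sum_(d <- divisors N | d != N) b d by move/addIr.
rewrite big_seq_cond [RHS]big_seq_cond; apply: eq_bigr => d /andP[].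
rewrite -dvdn_divisors // => dN ne; apply: IH; last exact: dvdn_gt0 dN.
by rewrite ltn_neqAle ne dvdn_leq.
Qed.

(** * Characterization of the numbers C(N, M) by traces of powers *)

Lemma trace_exp_circ (n : nat) (M : 'M[rat]_n) (m : nat) : (0 < m)%N ->
  \sum_(d <- divisors m) d%:R * circ d M = \tr (M ^+ m).
Proof.
move=> m0; rewrite -[RHS](mobius_inversion (fun k => \tr (M ^+ k))) //.
apply: eq_big_seq => d; rewrite -dvdn_divisors // => dm.
by rewrite mulVKf // pnatr_eq0 -lt0n (dvdn_gt0 m0).
Qed.

(** A double count: grouping the indices in S m by the value of the key, which
    runs over the divisors of m, turns the trace formula into the divisor sum
    that determines circ N M.  The ranges R d and S m are kept apart because
    the sums over a fibre and the sums giving the traces are written with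
    different finite ranges. *)
Lemma circ_fibre (I : eqType) (key : I -> nat) (w : I -> rat)
    (R S : nat -> seq I) (n : nat) (M : 'M[rat]_n) :
  (forall m, (0 < m)%N -> uniq (R m)) ->
  (forall m, (0 < m)%N -> uniq (S m)) ->
  (forall m i, (0 < m)%N ->
     (i \in S m) = (key i %| m)%N && (i \in R (key i))) ->
  (forall m, (0 < m)%N ->
     \sum_(i <- S m) (key i)%:R * w i = \tr (M ^+ m)) ->
  forall N, (0 < N)%N -> \sum_(i <- R N | key i == N) w i = circ N M.
Proof.
move=> uR uS SE trS N N0; have nz : N%:R != 0 :> rat by rewrite pnatr_eq0 -lt0n.
apply: (mulfI nz).
apply: (divisor_sums_inj _ (fun d => d%:R * \sum_(i <- R d | key i == d) w i)
                         (fun d => d%:R * circ d M)) => // m m0.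
rewrite trace_exp_circ // -trS //.
transitivity (\sum_(d <- divisors m) \sum_(i <- S m | key i == d)
                 (key i)%:R * w i).
  apply: eq_big_seq => d; rewrite -dvdn_divisors // => dm.
  have d0 := dvdn_gt0 m0 dm.
  rewrite big_distrr /= -big_filter -[RHS]big_filter.
  rewrite (perm_big [seq i <- S m | key i == d]) /=; last first.
    apply: uniq_perm; rewrite ?filter_uniq ?uR ?uS // => i; rewrite !mem_filter.
    by case: eqP => //= e; rewrite SE // e dm.
  by rewrite !big_filter; apply: eq_bigr => i /eqP->.
rewrite (exchange_big_dep xpredT) //=; apply: eq_big_seq => i.
rewrite SE // => /andP[im _]; rewrite big_mkcond /=.
rewrite (bigD1_seq (key i)) ?divisors_uniq -?dvdn_divisors //= eqxx.
by rewrite big1 ?addr0 // => d; rewrite eq_sym => /negPf->.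
Qed.

(** * Tensor products of powers *)

Lemma mxtrace_tens (K : comPzRingType) (m n : nat) (A : 'M[K]_m) (B : 'M[K]_n) :
  \tr (A *t B) = \tr A * \tr B.
Proof. by rewrite /mxtrace mulr_sum; apply: eq_bigr => i _; rewrite mxE. Qed.

Lemma tensmx_exp (K : comPzRingType) (m n : nat) (A : 'M[K]_m) (B : 'M[K]_n)
    (k : nat) :
  (A *t B) ^+ k = (A ^+ k) *t (B ^+ k).
Proof.
elim: k => [|k IH]; last first.
  by rewrite (exprS (A *t B)) (exprS A) (exprS B) -!mulmxE IH tensmx_mul.
apply/matrixP => i j; rewrite -[i]mxtens_unindexK -[j]mxtens_unindexK.
case: (mxtens_unindex i) (mxtens_unindex j) => i1 i2 [j1 j2]; rewrite tensmxE !mxE.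
by rewrite (can_eq (@mxtens_indexK m n)) xpair_eqE -natrM mulnb.
Qed.

(** The least m such that p divides a m and q divides b m, for coprime a and b;
    the closed form is the one that occurs in the summation condition. *)
Definition tens_key (a b p q : nat) : nat :=
  ((p * q) %/ gcdn (p * b) (q * a))%N.

(** The quotient is exact: the gcd divides pq a and pq b, hence pq (a, b). *)
Lemma tens_keyK (a b p q : nat) : coprime a b ->
  (tens_key a b p q * gcdn (p * b) (q * a) = p * q)%N.
Proof.
move=> /eqP ab; rewrite /tens_key divnK //.
rewrite -[X in (_ %| X)%N]muln1 -ab muln_gcdr dvdn_gcd; apply/andP; split.
  apply: dvdn_trans (dvdn_gcdr _ _) _.
  by rewrite -mulnA dvdn_mull.
apply: dvdn_trans (dvdn_gcdl _ _) _.
by rewrite mulnAC dvdn_mulr.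
Qed.

(** Multiplying by q and by p, the two conditions on the right become
    pq | q a m and pq | p b m, so together pq | (p b, q a) m. *)
Lemma dvdn_tens_key (a b p q m : nat) : coprime a b -> (0 < p)%N -> (0 < q)%N ->
  (tens_key a b p q %| m)%N = (p %| a * m)%N && (q %| b * m)%N.
Proof.
move=> ab p0 q0; have K := tens_keyK _ _ p q ab.
have G0 : (0 < gcdn (p * b) (q * a))%N.
  have : (0 < p * q)%N by rewrite muln_gt0 p0.
  by rewrite -K muln_gt0 => /andP[].
rewrite -(dvdn_pmul2r G0) K [(m * _)%N]mulnC muln_gcdl dvdn_gcd andbC -!mulnA.
by rewrite (mulnC p q) (dvdn_pmul2l q0) (mulnC q p) (dvdn_pmul2l p0).
Qed.

Lemma gcdn_cofactors (r s : nat) :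
  r = (gcdn r s * (r %/ gcdn r s))%N /\ s = (gcdn r s * (s %/ gcdn r s))%N.
Proof. by rewrite ![(gcdn r s * _)%N]mulnC !divnK ?dvdn_gcdl ?dvdn_gcdr. Qed.

Lemma coprime_cofactors (r s : nat) : (0 < r)%N ->
  coprime (s %/ gcdn r s) (r %/ gcdn r s).
Proof.
move=> r0; have g0 : (0 < gcdn r s)%N by rewrite gcdn_gt0 r0.
have [er es] := gcdn_cofactors r s.
by rewrite coprime_sym /coprime -(eqn_pmul2l g0) muln_gcdr -er -es muln1.
Qed.

Lemma tens_key_ratioE (N p q r s : nat) :
  (0 < p)%N -> (0 < q)%N -> (0 < r)%N -> (0 < s)%N ->
  ((p * q)%:R / (gcdn (p * r) (q * s))%:R == N%:R / (gcdn r s)%:R :> rat)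
  = (tens_key (s %/ gcdn r s) (r %/ gcdn r s) p q == N).
Proof.
move=> p0 q0 r0 s0; have [er es] := gcdn_cofactors r s.
have ab := coprime_cofactors r s r0.
set g := gcdn r s in er es ab *; have g0 : (0 < g)%N by rewrite gcdn_gt0 r0.
set G := gcdn (p * (r %/ g)) (q * (s %/ g)).
have G0 : (0 < G)%N.
  by rewrite gcdn_gt0 !muln_gt0 p0 divn_gt0 // dvdn_leq ?dvdn_gcdl.
have -> : gcdn (p * r) (q * s) = (g * G)%N.
  by rewrite {1}er {1}es muln_gcdr !(mulnCA g).
rewrite eqr_div ?pnatr_eq0 -?lt0n ?muln_gt0 ?g0 // -!natrM eqr_nat.
by rewrite -(tens_keyK _ _ p q ab) -/G -mulnA (mulnC G) eqn_pmul2r // muln_gt0 g0.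
Qed.

(** P and Q are arbitrary ranges that contain all the p and q that can occur,
    since the sums over least common multiples run over divisors and the
    general ones over intervals. *)
Lemma circ_tens_exp (n1 n2 : nat) (T1 : 'M[rat]_n1) (T2 : 'M[rat]_n2)
    (a b : nat) (P Q : nat -> seq nat) :
  (0 < a)%N -> (0 < b)%N -> coprime a b ->
  (forall d, (0 < d)%N -> [/\ uniq (P d), {in P d, forall p, (0 < p)%N}
     & {subset divisors (a * d) <= P d}]) ->
  (forall d, (0 < d)%N -> [/\ uniq (Q d), {in Q d, forall q, (0 < q)%N}
     & {subset divisors (b * d) <= Q d}]) ->
  forall N, (0 < N)%N ->
  \sum_(p <- P N) \sum_(q <- Q N | tens_key a b p q == N)
     (gcdn (p * b) (q * a))%:R * circ p T1 * circ q T2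
  = circ N ((T1 ^+ a) *t (T2 ^+ b)).
Proof.
move=> a0 b0 ab hP hQ N N0.
pose key (i : nat * nat) := tens_key a b i.1 i.2.
pose w (i : nat * nat) : rat :=
  (gcdn (i.1 * b) (i.2 * a))%:R * circ i.1 T1 * circ i.2 T2.
pose R d := [seq (p, q) | p <- P d, q <- Q d].
pose S m := [seq (p, q) | p <- divisors (a * m), q <- divisors (b * m)].
rewrite -(@circ_fibre _ key w R S) // => [|d d0|m m0|m [p q] m0|m m0].
- rewrite [RHS]big_mkcond /R big_allpairs; apply: eq_bigr => p _.
  by rewrite [LHS]big_mkcond.
- have [[uP _ _] [uQ _ _]] := (hP d d0, hQ d d0).
  by rewrite allpairs_uniq // => -[? ?] [? ?].
- by rewrite allpairs_uniq ?divisors_uniq // => -[? ?] [? ?].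
- rewrite /S /R /key /=.
  have am0 : (0 < a * m)%N by rewrite muln_gt0 a0.
  have bm0 : (0 < b * m)%N by rewrite muln_gt0 b0.
  apply/allpairsP/andP => [[[p' q'] /= [pS qS [-> ->]]]|[km /allpairsP]].
    rewrite -dvdn_divisors // in pS; rewrite -dvdn_divisors // in qS.
    have p0 := dvdn_gt0 am0 pS; have q0 := dvdn_gt0 bm0 qS.
    have km : (tens_key a b p' q' %| m)%N by rewrite dvdn_tens_key // pS.
    have k0 := dvdn_gt0 m0 km; split=> //; apply/allpairsP.
    (* The key divides itself, so the pair already occurs at level key. *)
    have := dvdnn (tens_key a b p' q').
    rewrite {1}dvdn_tens_key // => /andP[pk qk].
    exists (p', q'); split=> //=.
      by have [_ _] := hP _ k0; apply; rewrite -dvdn_divisors ?muln_gt0 ?a0.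
    by have [_ _] := hQ _ k0; apply; rewrite -dvdn_divisors ?muln_gt0 ?b0.
  case=> [[p' q'] /= [pR qR [ep eq_]]]; rewrite -{p'}ep -{q'}eq_ in pR qR.
  have k0 := dvdn_gt0 m0 km.
  have p0 : (0 < p)%N by have [_ + _] := hP _ k0; apply.
  have q0 : (0 < q)%N by have [_ + _] := hQ _ k0; apply.
  exists (p, q); move: km; rewrite dvdn_tens_key //= => /andP[pm qm].
  by rewrite -!dvdn_divisors.
rewrite tensmx_exp mxtrace_tens -!exprM -!trace_exp_circ ?muln_gt0 ?a0 ?b0 //.
rewrite /S big_allpairs big_distrl /=; apply: eq_bigr => p _.
rewrite big_distrr /=; apply: eq_bigr => q _.
rewrite /w /key /= !mulrA -natrM tens_keyK // natrM; ring.
Qed.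

(** * Powers of one matrix, and the three identities *)

(** Here the key of t is [l, t] / l, the least m such that t divides l m. *)
Lemma circ_exp (n : nat) (T : 'M[rat]_n) (N l : nat) : (0 < N)%N -> (0 < l)%N ->
  \sum_(t <- divisors (N * l) | lcmn l t == (N * l)%N) (t%:R / N%:R) * circ t T
  = circ N (T ^+ l).
Proof.
move=> N0 l0; pose key t := (lcmn l t %/ l)%N.
have keyK t : (key t * l)%N = lcmn l t by rewrite /key divnK ?dvdn_lcml.
have keyE t m : (key t %| m)%N = (t %| m * l)%N.
  by rewrite -(dvdn_pmul2r l0) keyK dvdn_lcm dvdn_mull.
rewrite -(@circ_fibre _ key (fun t => t%:R / (key t)%:R * circ t T)
            (fun d => divisors (d * l)) (fun d => divisors (d * l))) //.
- apply: eq_big => [t|t /eqP e]; first by rewrite -keyK eqn_pmul2r.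
  by rewrite /key e mulnK.
- by move=> m _; apply: divisors_uniq.
- by move=> m _; apply: divisors_uniq.
- move=> m t m0; rewrite -dvdn_divisors ?muln_gt0 ?m0 // keyE.
  case: (boolP (t %| m * l)%N) => //= tm; rewrite -dvdn_divisors -?keyE ?dvdnn //.
  by rewrite muln_gt0 l0 (dvdn_gt0 m0) // keyE.
move=> m m0; rewrite -exprM (mulnC l) -trace_exp_circ ?muln_gt0 ?m0 //.
apply: eq_big_seq => t; rewrite -dvdn_divisors ?muln_gt0 ?m0 // -keyE => km.
by rewrite mulrA (mulrCA _ t%:R) divff ?mulr1 // pnatr_eq0 -lt0n (dvdn_gt0 m0).
Qed.

Theorem theorem2p3 (n1 n2 n : nat)
    (T1 : 'M[rat]_n1) (T2 : 'M[rat]_n2) (T : 'M[rat]_n)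
    (hT1 : graph_matrix T1) (hT2 : graph_matrix T2) (hT : graph_matrix T) :
  [/\ forall N : nat, (0 < N)%N ->
        \sum_(s <- divisors N) \sum_(t <- divisors N | lcmn s t == N)
          (gcdn s t)%:R * circ s T1 * circ t T2
        = circ N (T1 *t T2),
      forall N l : nat, (0 < N)%N -> (0 < l)%N ->
        circ N (T ^+ l)
        = \sum_(t <- divisors (N * l) | lcmn l t == (N * l)%N)
            (t%:R / N%:R) * circ t T
    & forall N r s : nat, (0 < N)%N -> (0 < r)%N -> (0 < s)%N ->
        (gcdn r s)%:R
          * circ N ((T1 ^+ (s %/ gcdn r s)) *t (T2 ^+ (r %/ gcdn r s)))
        = \sum_(1 <= p < (N * s).+1)
            \sum_(1 <= q < (N * r).+1
                  | (p * q)%:R / (gcdn (p * r) (q * s))%:R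
                    == N%:R / (gcdn r s)%:R :> rat)
              (gcdn (r * p) (s * q))%:R * circ p T1 * circ q T2].
Proof.
split=> [N N0|N l N0 l0|N r s N0 r0 s0].
- have hdiv d : (0 < d)%N -> [/\ uniq (divisors d),
      {in divisors d, forall p, (0 < p)%N}
    & {subset divisors (1 * d) <= divisors d}].
    move=> d0; rewrite mul1n; split=> //; first exact: divisors_uniq.
    by move=> p; rewrite -dvdn_divisors //; apply: dvdn_gt0.
  rewrite -[T1 in RHS]expr1 -[T2 in RHS]expr1.
  rewrite -(circ_tens_exp _ _ _ _ _ _ divisors divisors) //.
  apply: eq_bigr => s _; apply: eq_big => [t|t _]; last by rewrite !muln1.
  by rewrite /tens_key !muln1.
- by rewrite circ_exp.
set g := gcdn r s; have g0 : (0 < g)%N by rewrite gcdn_gt0 r0.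
have [er es] := gcdn_cofactors r s.
have a0 : (0 < s %/ g)%N by rewrite divn_gt0 // dvdn_leq ?dvdn_gcdr.
have b0 : (0 < r %/ g)%N by rewrite divn_gt0 // dvdn_leq ?dvdn_gcdl.
have ab : coprime (s %/ g) (r %/ g) by apply: coprime_cofactors.
(* A divisor of c d is at most e d, as e = g c; this is what makes the finite
   ranges of p and q large enough. *)
have box c e : (0 < c)%N -> e = (g * c)%N -> forall d, (0 < d)%N ->
    [/\ uniq (index_iota 1 (d * e).+1),
        {in index_iota 1 (d * e).+1, forall p, (0 < p)%N}
      & {subset divisors (c * d) <= index_iota 1 (d * e).+1}].
  move=> c0 -> d d0; split=> [|p|p]; first exact: iota_uniq.
    by rewrite mem_index_iota => /andP[].
  have cd0 : (0 < c * d)%N by rewrite muln_gt0 c0.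
  rewrite -dvdn_divisors // mem_index_iota => pcd.
  rewrite (dvdn_gt0 cd0) //= ltnS (leq_trans (dvdn_leq cd0 pcd)) //.
  by rewrite mulnC leq_mul2l leq_pmull ?orbT.
rewrite -(circ_tens_exp _ _ T1 T2 _ _ _ _ a0 b0 ab (box _ _ a0 es) (box _ _ b0 er)) //.
rewrite big_distrr /=; apply: eq_big_seq => p.
rewrite mem_index_iota => /andP[p0 _]; rewrite big_distrr /=.
rewrite big_seq_cond [RHS]big_seq_cond; apply: eq_big => [q|q _]; last first.
  have -> : gcdn (r * p) (s * q) = (g * gcdn (p * (r %/ g)) (q * (s %/ g)))%N.
    by rewrite muln_gcdr ![(g * (_ * _))%N]mulnCA -er -es (mulnC r) (mulnC s).
  by rewrite natrM !mulrA.
case: (boolP (q \in _)) => //=; rewrite mem_index_iota => /andP[q0 _].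
by rewrite (tens_key_ratioE N p q r s).
Qed.
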